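(* For a given DAG $\mathcal{G}$ on variables $X_1,\dots,X_d$, let $P$ be the probability distribution for data generated under an ICM generative process with respect to $\mathcal{G}$, and let $p$ be the corresponding density. Let $\mathbf{X}\subseteq\{X_{i;n}: i\in[d],\ n\in[N]\}$ be an intervention set and $\hat{\mathbf{x}}$ a realization of $\mathbf{X}$. Then the post-interventional distribution after intervening on $\mathbf{X}=\hat{\mathbf{x}}$ has density given by $$p(\mathbf{x}_{:;1},\dots,\mathbf{x}_{:;N}\mid do(\mathbf{X}=\hat{\mathbf{x}}))=\prod_{i\in I_{\mathbf{X}}}p\big(\mathbf{x}_{i;[\neg\mathbf{N}_i]}\mid \mathbf{pa}^{\mathcal{G}}_{i;[\neg\mathbf{N}_i]}\big)\ \prod_{i\notin I_{\mathbf{X}}}p\big(\mathbf{x}_{i;[N]}\mid\mathbf{pa}^{\mathcal{G}}_{i;[N]}\big)\Big|_{\mathbf{X}=\hat{\mathbf{x}}},$$ where $I_{\mathbf{X}}:=\{i : X_{i;n}\in\mathbf{X}\}$ is the set of variable indices being intervened on, $\mathbf{N}_i:=\{n : X_{i;n}\in\mathbf{X}\}$ is the set of position indices corresponding to variable index $i$ in the intervention set $\mathbf{X}$, and $[\neg\mathbf{N}_i]$ is the set of positive integers less than or equal to $N$ excluding values in $\mathbf{N}_i$.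
   Context: Notation. $[N]:=\{1,\dots,N\}$, where $N$ is the number of positions observed. Data form a sequence of arrays $\{\mathbf{X}_{:;n}\}_{n\in\mathbb{N}}$, $\mathbf{X}_{:;n}=(X_{1;n},\dots,X_{d;n})$, where $X_{i;n}$ is the $i$-th variable (variable index $i$) at position $n$. For a set of positions $S$, $\mathbf{X}_{i;S}:=(X_{i;n})_{n\in S}$. In $\mathcal{G}$, $\mathbf{PA}_i$ denotes the parents of $X_i$, $\mathbf{ND}_i$ its non-descendants, and $\overline{\mathbf{ND}}_i$ its non-descendants excluding its parents. $\mathbf{PA}_{i;n}$ (also written $\mathbf{PA}^{\mathcal{G}}_{i;n}$) denotes the parents of $X_{i;n}$ at position $n$, i.e. $\{X_{j;n}: X_j\in\mathbf{PA}_i\}$, and $\mathbf{PA}_{i;S}=(\mathbf{PA}_{i;n})_{n\in S}$; similarly for $\mathbf{ND}$ and $\overline{\mathbf{ND}}$. Lowercase letters denote realizations. ICM generative process. Data are generated from an ICM generative process with respect to $\mathcal{G}$ if $\{\mathbf{X}_{:;n}\}$ is infinitely exchangeable (for every $N$ the joint law of $(\mathbf{X}_{:;1},\dots,\mathbf{X}_{:;N})$ is invariant under permutations of the positions) and, for all $i\in[d]$ and $n\in\mathbb{N}$, $\mathbf{X}_{i;[n]}$ is conditionally independent of $(\overline{\mathbf{ND}}_{i;[n]},\mathbf{ND}_{i;n+1})$ given $\mathbf{PA}_{i;[n]}$. By the known causal de Finetti theorems, equivalently the joint distribution can be represented as $$P(\mathbf{X}_{:;[N]}=\mathbf{x}_{:;[N]})=\int\cdots\int\prod_{n=1}^{N}\prod_{i=1}^{d}p(x_{i;n}\mid\mathbf{pa}^{\mathcal{G}}_{i;n},\boldsymbol{\theta}_i)\,d\nu_1(\boldsymbol{\theta}_1)\cdots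 d\nu_d(\boldsymbol{\theta}_d)\qquad(\ast)$$ where the $\nu_i$ are probability measures. Any probability measure is assumed to have a corresponding density function. Intervention. For a set $\mathbf{X}$ of variables and a realization $\hat{\mathbf{x}}$, the post-interventional distribution $P(\cdot\mid do(\mathbf{X}=\hat{\mathbf{x}}))$ is the one induced by setting, in $(\ast)$, $p(x_{i;n}\mid\mathbf{pa}^{\mathcal{G}}_{i;n},\boldsymbol{\theta}_i)=\delta(X_{i;n}=\hat{x}_{i;n})$ (the delta distribution at $\hat{x}_{i;n}$) for every $X_{i;n}\in\mathbf{X}$, and substituting $\mathbf{X}=\hat{\mathbf{x}}$ in the remaining conditional distributions. The conditional densities on the right-hand side of the claim are those of the pre-interventional distribution $P$. The symbol $|_{\mathbf{X}=\hat{\mathbf{x}}}$ enforces that the arguments $\mathbf{x}_{:;1},\dots,\mathbf{x}_{:;N}$ are consistent with the realization $\hat{\mathbf{x}}$ of $\mathbf{X}$; otherwise the expression takes the value $0$. *)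

(* Defs.v *)
From HB Require Import structures.
From mathcomp Require Import all_boot all_order all_algebra all_fingroup.
From mathcomp Require Import all_classical all_reals all_analysis measurable_realfun.

Set Implicit Arguments.
Unset Strict Implicit.
Unset Printing Implicit Defensive.

Import Order.TTheory GRing.Theory Num.Theory.

Local Open Scope classical_set_scope.
Local Open Scope ring_scope.
Local Open Scope ereal_scope.

Section product_space.
Context {C : Type} {dT : C -> measure_display}.
Variable T : forall c, measurableType (dT c).

Definition cylinders : set (set (forall c, T c)) :=
  [set A | exists c (B : set (T c)), measurable B /\ A = [set x | B (x c)]].

(* The product of the T c with the product sigma-algebra; elements are plain
   dependent functions. *)
Definition prodspace := g_sigma_algebraType cylinders.

End product_space.

Section iterated_integral.
Context {R : realType} {C : finType} {dT : C -> measure_display}.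
Context {T : forall c, measurableType (dT c)}.

(* Integrates out the coordinates in S, one after the other, the remaining
   coordinates being kept as in x. For nonnegative f and sigma-finite m this is
   the integral against the product of the (m c), c in S, by Tonelli. For
   S = setT the result does not depend on x. *)
Definition iint (m : forall c, set (T c) -> \bar R) (S : {set C})
    (f : prodspace T -> \bar R) (x : prodspace T) : \bar R :=
  foldr (fun c (g : prodspace T -> \bar R) y => \int[m c]_t g (dfwith y c t))
        f (enum S) x.

Definition iintT m (f : prodspace T -> \bar R) : \bar R :=
  iint m [set: C] f point.

Definition has_density (m : forall c, set (T c) -> \bar R)
    (law : set (prodspace T) -> \bar R) (f : prodspace T -> \bar R) : Prop :=
  [/\ measurable_fun setT f, forall x, 0 <= f x &
      forall A, measurable A -> law A = iintT m (fun x => f x * (\1_A x)%:E)].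

(* The marginal density of the coordinates in S; it only depends on the
   restriction of x to S. *)
Definition marginal m (f : prodspace T -> \bar R) (S : {set C}) x : \bar R :=
  iint m (~: S) f x.

(* p(x_A | x_B), computed from the joint density f. *)
Definition cond_density m (f : prodspace T -> \bar R) (A B : {set C}) x :=
  marginal m f (A :|: B) x / marginal m f B x.

Definition cond_density_defined m (f : prodspace T -> \bar R) (B : {set C}) x :=
  0 < marginal m f B x < +oo.

End iterated_integral.

Section conditional_independence.
Context {R : realType} {dO : measure_display} {Omega : measurableType dO}.
Variable P : probability Omega R.

(* g (W) is a version of the conditional probability P(D | W). *)
Definition is_cond_prob {dW} {TW : measurableType dW} (W : Omega -> TW)
    (D : set Omega) (g : TW -> R) : Prop :=
  measurable_fun setT g /\
  forall E, measurable E ->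
    P (D `&` W @^-1` E) = \int[P]_(w in W @^-1` E) (g (W w))%:E.

Definition cond_indep {dU dV dW} {TU : measurableType dU}
    {TV : measurableType dV} {TW : measurableType dW}
    (U : Omega -> TU) (V : Omega -> TV) (W : Omega -> TW) : Prop :=
  forall A B, measurable A -> measurable B ->
  exists gA gB : TW -> R,
    [/\ is_cond_prob W (U @^-1` A) gA, is_cond_prob W (V @^-1` B) gB &
        is_cond_prob W (U @^-1` A `&` V @^-1` B) (fun t => gA t * gB t)%R].

End conditional_independence.

Section graph.
Variable d : nat.

(* e i j is the edge X_i -> X_j. *)
Definition acyclic (e : rel 'I_d) := forall i j, e i j -> ~~ connect e j i.

Definition PA (e : rel 'I_d) (i : 'I_d) : {set 'I_d} := [set j | e j i].

(* A node is not a non-descendant of itself: connect is reflexive. *)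
Definition ND (e : rel 'I_d) (i : 'I_d) : {set 'I_d} :=
  [set j | ~~ connect e i j].

Definition NDbar (e : rel 'I_d) (i : 'I_d) : {set 'I_d} := ND e i :\: PA e i.

End graph.

Section icm.
Context {R : realType} {d : nat} {dT : 'I_d -> measure_display}.
Variable T : forall i, measurableType (dT i).

(* Values of the variables with index in S, at one position. *)
Definition rowspace (S : {set 'I_d}) :=
  prodspace (fun j : {j | j \in S} => T (val j)).

(* x_{:;[N]}. Positions are numbered from 0, so that [N] is 'I_N. *)
Definition array (N : nat) := prodspace (fun c : 'I_d * 'I_N => T c.1).

Section process.
Context {dO : measure_display} {Omega : measurableType dO}.
Variable P : probability Omega R.
Variable X : forall i : 'I_d, nat -> {RV P >-> T i}.

Definition data (N : nat) (s : 'I_N -> 'I_N) : Omega -> array N :=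
  fun w c => X c.1 (s c.2) w.

Definition data_law (N : nat) (A : set (array N)) : \bar R :=
  P (data id @^-1` A).

Definition inf_exchangeable : Prop :=
  forall N (s : {perm 'I_N}) (A : set (array N)), measurable A ->
    P (data s @^-1` A) = P (data id @^-1` A).

(* The family of the X_{i;n} for (i, n) in S. *)
Definition vars (S : pred ('I_d * nat)) :
    Omega -> prodspace (fun c : {c | S c} => T (val c).1) :=
  fun w c => X (val c).1 (val c).2 w.

Arguments vars S _ : clear implicits.

(* Positions being numbered from 0, [n] is the set of the m < n, and the
   position n + 1 has number n. *)
Definition icm_process (e : rel 'I_d) : Prop :=
  inf_exchangeable /\
  forall (i : 'I_d) (n : nat),
    cond_indep P
      (vars [pred c | (c.1 == i) && (c.2 < n)%N])
      (vars [pred c | (c.1 \in NDbar e i) && (c.2 < n)%N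
                   || (c.1 \in ND e i) && (c.2 == n)])
      (vars [pred c | (c.1 \in PA e i) && (c.2 < n)%N]).

End process.

Section representation.
Variable e : rel 'I_d.
Variable mu : forall i, {sigma_finite_measure set T i -> \bar R}.
Context {dH : 'I_d -> measure_display}.
Variable Theta : forall i, measurableType (dH i).
Variable nu : forall i, probability (Theta i) R.

(* k i theta pa t is p(x_i = t | pa, theta_i). *)
Variable k : forall i, Theta i -> rowspace (PA e i) -> T i -> R.

Definition is_cond_density_family : Prop :=
  forall i,
  [/\ measurable_fun setT
        (fun z : Theta i * rowspace (PA e i) * T i => k z.1.1 z.1.2 z.2),
      forall th pa t, (0 <= k (i:=i) th pa t)%R &
      forall th pa, \int[mu i]_t (k (i:=i) th pa t)%:E = 1].

Variable N : nat.

(* The reference measure of arrays is the product over all (i, n) of mu i. *)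
Definition refm (c : 'I_d * 'I_N) : set (T c.1) -> \bar R := mu c.1.

Definition pa (x : array N) (i : 'I_d) (n : 'I_N) : rowspace (PA e i) :=
  fun j => x (val j, n).

Arguments pa x i n : clear implicits.

Definition icm_density (x : array N) : \bar R :=
  iintT (fun i => nu i : set (Theta i) -> \bar R) (fun th : prodspace Theta =>
    (\prod_(n < N) \prod_(i < d) k (th i) (pa x i n) (x (i, n)))%:E).

(* The intervention do(X = xhat): Xs is the set of the (i, n) such that X_{i;n}
   is in X, and only the coordinates of xhat in Xs are relevant. *)
Variables (Xs : {set 'I_d * 'I_N}) (xhat : array N).

Definition subst (x : array N) : array N :=
  fun c => if c \in Xs then xhat c else x c.

Definition consistent (x : array N) : bool :=
  [forall c : 'I_d * 'I_N, (c \in Xs) ==> (x c == xhat c)].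

Definition do_refm (c : 'I_d * 'I_N) : set (T c.1) -> \bar R :=
  if c \in Xs then dirac (xhat c) else mu c.1.

(* The conditional distribution of X_{i;n} is k times mu i if (i, n) is not in
   Xs, and the Dirac measure at xhat_{i;n} otherwise. *)
Definition do_law (A : set (array N)) : \bar R :=
  iintT (fun i => nu i : set (Theta i) -> \bar R) (fun th : prodspace Theta =>
    iintT do_refm (fun x =>
      (\prod_(n < N) \prod_(i < d | (i, n) \notin Xs)
          k (th i) (pa (subst x) i n) (x (i, n)))%:E * (\1_A x)%:E)).

(* Density of do_law with respect to the product of the do_refm: relatively to
   the Dirac measure at xhat_{i;n}, the delta distribution is the indicator of
   x_{i;n} = xhat_{i;n}. *)
Definition do_density (x : array N) : \bar R :=
  iintT (fun i => nu i : set (Theta i) -> \bar R) (fun th : prodspace Theta =>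
    (\prod_(n < N) \prod_(i < d)
       if (i, n) \in Xs then (x (i, n) == xhat (i, n))%:R
       else k (th i) (pa (subst x) i n) (x (i, n)))%:E).

Definition int_vars : {set 'I_d} := [set c.1 | c in Xs].

Definition free_pos (i : 'I_d) : {set 'I_N} := [set n | (i, n) \notin Xs].

Definition var_coords (i : 'I_d) (S : {set 'I_N}) : {set 'I_d * 'I_N} :=
  finset.setX [set i] S.

Definition pa_coords (i : 'I_d) (S : {set 'I_N}) : {set 'I_d * 'I_N} :=
  finset.setX (PA e i) S.

(* p(x_{i;S} | pa_{i;S}), from the joint density p of the first N positions *)
Definition mech_density (p : array N -> \bar R) i (S : {set 'I_N}) x : \bar R :=
  cond_density refm p (var_coords i S) (pa_coords i S) x.

Definition mech_density_defined (p : array N -> \bar R) i (S : {set 'I_N}) x :=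
  cond_density_defined refm p (pa_coords i S) x.

Definition truncated_factorization (p : array N -> \bar R) (x : array N) :=
  if consistent x then
    (\prod_(i in int_vars) mech_density p i (free_pos i) x) *
    (\prod_(i | i \notin int_vars) mech_density p i [set: 'I_N] x)
  else 0.

End representation.
End icm.

(* Main.v *)
Require Import Defs.
From HB Require Import structures.
From mathcomp Require Import all_boot all_order all_algebra all_fingroup.
From mathcomp Require Import all_classical all_reals all_analysis measurable_realfun.

Set Implicit Arguments.
Unset Strict Implicit.
Unset Printing Implicit Defensive.

Import Order.TTheory GRing.Theory Num.Theory.

Local Open Scope classical_set_scope.
Local Open Scope ring_scope.
Local Open Scope ereal_scope.

(* Since the theta_i are independent, the joint density factors as a product over
   i of mixtures mech i S = int prod_(n in S) k(theta_i, pa_{i;n}, x_{i;n}) dnu_i,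
   with S = [N]. Integrating out a set of coordinates closed under children only
   removes the corresponding kernels, each of them having integral 1. Applied to
   the descendants of i, this shows that the marginal density of (x_{i;S}, pa_{i;S})
   is mech i S times that of pa_{i;S}, so that p(x_{i;S} | pa_{i;S}) = mech i S. On
   consistent points the delta distributions equal 1 and the interventional density
   is the product of the mech i (free_pos i). *)

(** * Measurability of finite products and of maps into the product space *)

Lemma measurable_prod_cond {R : realType} {dY} {Y : measurableType dY}
    {I : finType} (P : pred I) (h : I -> Y -> R) :
  (forall i, P i -> measurable_fun setT (h i)) ->
  measurable_fun setT (fun y => \prod_(i | P i) h i y)%R.
Proof.
move=> mh; under eq_fun do rewrite -big_filter.
by apply: measurable_prod => i; rewrite mem_filter => /andP[/mh].
Qed.

Section prodspace_measurability.
Context {C : finType} {dT : C -> measure_display}.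
Variable T : forall c, measurableType (dT c).

Lemma measurable_coord c : measurable_fun setT (fun x : prodspace T => x c).
Proof.
move=> _ B mB; rewrite setTI; apply: sub_sigma_algebra.
by exists c, B.
Qed.

Lemma measurable_to_prodspace {dY} {Y : measurableType dY}
    (f : Y -> prodspace T) :
  (forall c, measurable_fun setT (fun y => f y c)) -> measurable_fun setT f.
Proof.
move=> mf; apply: (@measurability _ _ Y (prodspace T) setT f (cylinders (T:=T))) => //.
move=> _ [_ [c [B [mB ->]]] <-]; rewrite setTI.
by have := mf c measurableT _ mB; rewrite setTI.
Qed.

Lemma measurable_fun_coord {dY} {Y : measurableType dY} c (f : Y -> prodspace T) :
  measurable_fun setT f -> measurable_fun setT (fun y => f y c).
Proof.
move=> mf; rewrite -[X in measurable_fun _ X]/((fun x : prodspace T => x c) \o f).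
by apply: measurableT_comp => //; exact: measurable_coord.
Qed.

Lemma measurable_dfwith {dY} {Y : measurableType dY} c
    (f : Y -> prodspace T) (g : Y -> T c) :
  measurable_fun setT f -> measurable_fun setT g ->
  measurable_fun setT (fun y => dfwith (f y) c (g y) : prodspace T).
Proof.
move=> mf mg; apply: measurable_to_prodspace => c'.
have [->|cc'] := eqVneq c' c.
  rewrite (_ : (fun _ => _) = g)//.
  by apply/funext => z; exact: dfwithin.
rewrite (_ : (fun _ => _) = (fun x : prodspace T => x c') \o f).
  by apply: measurableT_comp => //; exact: measurable_coord.
by apply/funext => z /=; rewrite dfwithout// eq_sym.
Qed.

Lemma measurable_section {dZ} {Z : measurableType dZ} c (f : prodspace T -> Z) x :
  measurable_fun setT f -> measurable_fun setT (fun t : T c => f (dfwith x c t)).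
Proof.
move=> mf; apply: (measurableT_comp mf (g := fun t : T c => dfwith x c t : prodspace T)).
exact: measurable_dfwith.
Qed.

End prodspace_measurability.

(** * Iterated integrals of nonnegative functions: Tonelli and reordering *)

Section iterated_integral_theory.
Context {R : realType} {C : finType} {dT : C -> measure_display}.
Context {T : forall c, measurableType (dT c)}.
Variable m : forall c, {sigma_finite_measure set T c -> \bar R}.

Implicit Types (s : seq C) (f g : prodspace T -> \bar R) (x : prodspace T).

(** Indexing by a sequence instead of a set permits induction on, and explicit control of, the order
    of integration. *)
Definition iints s f : prodspace T -> \bar R :=
  foldr (fun c (g : prodspace T -> \bar R) y => \int[m c]_t g (dfwith y c t)) f s.

Lemma iintE (S : {set C}) f : iint (fun c => m c) S f = iints (enum S) f.
Proof. by []. Qed.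

Lemma iints_cons c s f x :
  iints (c :: s) f x = \int[m c]_t iints s f (dfwith x c t).
Proof. by []. Qed.

Lemma iints_cat s1 s2 f : iints (s1 ++ s2) f = iints s1 (iints s2 f).
Proof. by rewrite /iints foldr_cat. Qed.

Lemma iints_ge0 s f : (forall x, 0 <= f x) -> forall x, 0 <= iints s f x.
Proof.
by move=> f0; elim: s => // c s IH x; apply: integral_ge0 => t _; exact: IH.
Qed.

(** The parameter gives joint measurability, which Tonelli needs as soon as the iterated integral is
    integrated again over another variable. *)
Lemma measurable_iints_param {dY} {Y : measurableType dY} s
    (f : Y * prodspace T -> \bar R) :
  measurable_fun setT f -> (forall z, 0 <= f z) ->
  measurable_fun setT (fun z => iints s (fun x => f (z.1, x)) z.2).
Proof.
move=> mf f0; elim: s => [|c s IH].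
  rewrite (_ : (fun _ => _) = f)//.
  by apply/funext => -[].
pose h (z : (Y * prodspace T) * T c) :=
  iints s (fun x => f (z.1.1, x)) (dfwith z.1.2 c z.2).
apply: (@measurable_fun_fubini_tonelli_F _ _ _ _ _ (m c) h); last first.
  by move=> z; exact: iints_ge0.
apply: (measurableT_comp IH
  (g := fun z : (Y * prodspace T) * T c => (z.1.1, dfwith z.1.2 c z.2 : prodspace T))).
apply: measurable_fun_pair.
  by apply: measurableT_comp.
by apply: measurable_dfwith => //; apply: measurableT_comp.
Qed.

Lemma measurable_iints s f :
  measurable_fun setT f -> (forall x, 0 <= f x) -> measurable_fun setT (iints s f).
Proof.
move=> mf f0.
(* The parameter is a dummy here; the diagonal map then supplies the base point. *)
have := @measurable_iints_param _ (prodspace T) s (f \o snd).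
move=> /(_ (measurableT_comp mf measurable_snd) (fun=> f0 _)) mh.
apply: (measurableT_comp mh (g := fun x : prodspace T => (x, x))).
by apply: measurable_fun_pair.
Qed.

(** One application of Tonelli per coordinate of [s]. *)
Lemma iints_fubini {dY} {Y : measurableType dY}
    (n : {sigma_finite_measure set Y -> \bar R}) s (f : Y * prodspace T -> \bar R) x :
  measurable_fun setT f -> (forall z, 0 <= f z) ->
  \int[n]_y iints s (fun x => f (y, x)) x =
  iints s (fun x => \int[n]_y f (y, x)) x.
Proof.
move=> mf f0; elim: s x => // c s IH x.
pose h (z : Y * T c) := iints s (fun x => f (z.1, x)) (dfwith x c z.2).
have mh : measurable_fun setT h.
  apply: (measurableT_comp (measurable_iints_param s mf f0)
    (g := fun z : Y * T c => (z.1, dfwith x c z.2 : prodspace T))).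
  by apply: measurable_fun_pair => //; exact: measurable_dfwith.
have h0 z : 0 <= h z by exact: iints_ge0.
rewrite iints_cons [LHS](fubini_tonelli h mh h0)/=.
by apply: eq_integral => t _; rewrite -IH.
Qed.

Lemma iints_swap c1 c2 s f x : measurable_fun setT f -> (forall x, 0 <= f x) ->
  iints (c1 :: c2 :: s) f x = iints (c2 :: c1 :: s) f x.
Proof.
move=> mf f0; have [->//|c12] := eqVneq c1 c2.
have mg := measurable_iints s mf f0; have g0 := iints_ge0 s f0.
pose h (z : T c1 * T c2) := iints s f (dfwith (dfwith x c1 z.1) c2 z.2).
have mh : measurable_fun setT h.
  apply: (measurableT_comp mg
    (g := fun z : T c1 * T c2 => dfwith (dfwith x c1 z.1) c2 z.2 : prodspace T)).
  by do 2!apply: measurable_dfwith => //.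
rewrite [LHS](fubini_tonelli h mh (fun=> g0 _))/=.
apply: eq_integral => t2 _; apply: eq_integral => t1 _; rewrite /h /=.
(* The two updates of [x] commute because [c1 != c2]. *)
congr iints; apply/functional_extensionality_dep => c.
have [->|cc1] := eqVneq c c1.
  by rewrite dfwithin dfwithout 1?eq_sym// dfwithin.
have [->|cc2] := eqVneq c c2.
  by rewrite dfwithin dfwithout// dfwithin.
by rewrite !dfwithout// eq_sym.
Qed.

Lemma eq_iints s f g : (forall x, f x = g x) -> iints s f = iints s g.
Proof. by move=> /funext ->. Qed.

(** Adjacent swaps generate all reorderings; [bubble] iterates them to bring one coordinate to the
    front. *)
Lemma iints_perm s1 s2 f x : measurable_fun setT f -> (forall x, 0 <= f x) ->
  perm_eq s1 s2 -> iints s1 f x = iints s2 f x.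
Proof.
move=> mf f0.
have bubble c s s' y : iints (s ++ c :: s') f y = iints (c :: s ++ s') f y.
  elim: s y => // c' s IH y; rewrite cat_cons -cat_cons /= -/(iints _ _).
  rewrite -[RHS]/(iints (c :: c' :: s ++ s') f y) iints_swap// iints_cons.
  by apply: eq_integral => t _; rewrite IH.
elim: s1 s2 x => [|c s1 IH] s2 x.
  by rewrite perm_sym => /perm_nilP ->.
(* The head [c] of [s1] occurs in [s2]: splitting [s2] there and moving [c] to the front leaves the
   tails to the induction hypothesis. *)
move=> s12; have cs2 : c \in s2 by rewrite -(perm_mem s12) mem_head.
move: s12; rewrite -(cat_take_drop (index c s2) s2).
rewrite (drop_nth c) ?index_mem// nth_index//.
move: (take _ _) (drop _ _) => u v.
rewrite perm_sym (perm_catCA u [:: c] v) perm_cons perm_sym => s12.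
rewrite bubble !iints_cons.
by apply: eq_integral => t _; apply: IH.
Qed.

(** Nonnegativity replaces integrability: the factor and the integrals may be infinite. *)
Lemma iints_mull s f g x :
  measurable_fun setT f -> (forall x, 0 <= f x) -> (forall x, 0 <= g x) ->
  (forall x c t, c \in s -> g (dfwith x c t) = g x) ->
  iints s (fun x => g x * f x) x = g x * iints s f x.
Proof.
move=> mf f0 g0; elim: s x => // c s IH x gE; rewrite iints_cons.
under eq_integral => t _.
  rewrite IH; last by move=> y c' t' c's; rewrite gE// in_cons c's orbT.
  rewrite gE ?mem_head//; over.
rewrite ge0_integralZl//; first
  by apply: (measurable_section (f := iints s f)); exact: measurable_iints.
by move=> t _; exact: iints_ge0.
Qed.

(** * Iterated integrals of products *)

Lemma measurable_prod_coord s (G : forall c, T c -> R) :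
  (forall c, measurable_fun setT (G c)) ->
  measurable_fun setT (fun x : prodspace T => (\prod_(c <- s) G c (x c))%:E).
Proof.
move=> mG; apply/measurable_EFinP.
apply: (@measurable_prod _ _ _ _ _ s (fun c (x : prodspace T) => G c (x c))).
by move=> c _; apply: (measurableT_comp (mG c) (g := fun x : prodspace T => x c));
  exact: measurable_coord.
Qed.

(** Since [s] has no repetition, the factor of its head is constant along the tail and leaves the
    inner integrals. With the measures [nu] this expresses the independence of the parameters. *)
Lemma iints_prod_coord s (G : forall c, T c -> R) x : uniq s ->
  (forall c, measurable_fun setT (G c)) -> (forall c t, (0 <= G c t)%R) ->
  iints s (fun x => (\prod_(c <- s) G c (x c))%:E) x =
  \prod_(c <- s) \int[m c]_t (G c t)%:E.
Proof.
move=> us mG G0; elim: s us x => [_ x|c s IH /= /andP[cs us] x].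
  by rewrite /= !big_nil.
rewrite big_cons.
rewrite (@eq_iints s _ (fun x => (G c (x c))%:E * (\prod_(c <- s) G c (x c))%:E)); last first.
  by move=> y; rewrite big_cons EFinM.
under eq_integral => t _.
  rewrite (@iints_mull s _ (fun x => (G c (x c))%:E)); first last.
  - move=> y c' t' c's; rewrite dfwithout//.
    by apply: contraNneq cs => <-.
  - by move=> y; rewrite lee_fin.
  - by move=> y; rewrite lee_fin prodr_ge0.
  - exact: measurable_prod_coord.
  rewrite dfwithin IH//; over.
rewrite ge0_integralZr//.
- exact/measurable_EFinP.
- by move=> t _; rewrite lee_fin.
- by apply: prode_ge0 => c' _; apply: integral_ge0 => t _; rewrite lee_fin.
Qed.

Lemma iintT_prod_coord (G : forall c, T c -> R) :
  (forall c, measurable_fun setT (G c)) -> (forall c t, (0 <= G c t)%R) ->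
  iintT (fun c => m c) (fun x => (\prod_c G c (x c))%:E) =
  \prod_c \int[m c]_t (G c t)%:E.
Proof.
move=> mG G0; rewrite /iintT iintE.
rewrite (@eq_iints _ _ (fun x => (\prod_(c <- enum [set: C]%SET) G c (x c))%:E)); last first.
  by move=> x; rewrite big_enum/=; congr EFin; apply: eq_bigl => c; rewrite inE.
apply: (etrans (iints_prod_coord _ (enum_uniq _) mG G0)).
by rewrite big_enum/=; apply: eq_bigl => c; rewrite inE.
Qed.

(* The relation ch is an acyclic child relation, as witnessed by the rank r. A
   coordinate of least rank in D is integrated out last: at that point only its
   own weight still depends on it. *)
Lemma iint_prod_kernel (ch : rel C) (r : C -> nat) (w : C -> prodspace T -> R)
    (D : {set C}) x :
  (forall c, measurable_fun setT (w c)) ->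
  (forall c x, (0 <= w c x)%R) ->
  (forall c c' x t, c != c' -> ~~ ch c' c -> w c (dfwith x c' t) = w c x) ->
  (forall c x, \int[m c]_t (w c (dfwith x c t))%:E = 1) ->
  (forall c c', ch c c' -> (r c < r c')%N) ->
  (forall c c', c \in D -> ch c c' -> c' \in D) ->
  iint (fun c => m c) D (fun x => (\prod_c w c x)%:E) x =
  (\prod_(c | c \notin D) w c x)%:E.
Proof.
move=> mw w0 wE w1 chr; rewrite iintE.
have mW (P : pred C) : measurable_fun setT (fun x => (\prod_(c | P c) w c x)%:E).
  by apply/measurable_EFinP; exact: measurable_prod_cond.
(* Induction on a bound for the cardinality of [D], generalized over the base point. *)
move: {2}#|D| (leqnn #|D|) => n; elim: n D x => [|n IH] D x.
  rewrite leqn0 cards_eq0 => /eqP -> _; rewrite enum_set0 /=.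
  by congr EFin; apply: eq_bigl => c; rewrite inE.
have [->|/set0Pn[c0 c0D]] := eqVneq D finset.set0.
  move=> _ _; rewrite enum_set0 /=.
  by congr EFin; apply: eq_bigl => c; rewrite inE.
case: (arg_minnP r c0D) => s sD' smin Dn Dch; have sD : s \in D := sD'.
rewrite (@iints_perm (enum D) (s :: enum (D :\ s))); first last.
- apply: uniq_perm; rewrite /= ?enum_uniq ?andbT ?mem_enum ?inE ?eqxx//.
  by move=> c; rewrite in_cons !mem_enum !inE; case: eqVneq => // ->.
- by move=> y; rewrite lee_fin prodr_ge0.
- exact: mW.
rewrite iints_cons.
under eq_integral => t _.
  rewrite IH; first last.
  (* [D :\ s] is still closed under children: a child has a larger rank than its parent, so it
     cannot be the minimal [s]. *)
  - move=> c c'; rewrite !inE => /andP[_ cD] cc'; rewrite (Dch c)// andbT.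
    by apply: contraTneq (chr _ _ cc') => ->; rewrite -leqNgt smin.
  - by rewrite -ltnS (leq_trans _ Dn)// [leqRHS](cardsD1 s) sD.
  rewrite (bigD1 s) ?inE ?eqxx//= EFinM.
  rewrite (eq_bigl (fun c => c \notin D)); last first.
    by move=> c; rewrite !inE; case: (eqVneq c s) => [->|_]; rewrite ?sD//= andbT.
  (* A weight outside [D] ignores coordinate [s]: its index is neither [s] nor a child of [s], all
     of which lie in [D]. *)
  rewrite (eq_bigr (fun c => w c x)); last first.
    move=> c cD; rewrite wE//; first by apply: contraNneq cD => ->.
    by apply: contra cD; exact: Dch.
  over.
rewrite ge0_integralZr ?w1 ?mul1e//.
- by apply/measurable_EFinP; exact: (measurable_section (f := w s)).
- by move=> t _; rewrite lee_fin.
- by rewrite lee_fin prodr_ge0.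
Qed.

(** Integration against a Dirac measure evaluates at [a c], so [f] and [g] are only compared where
    the coordinates in [A] agree with [a]. The last hypothesis covers the coordinates of [A] that
    [s] does not integrate. *)
Lemma eq_iints_dirac (a : prodspace T) (A : {set C}) s f g x :
  (forall c, c \in A -> m c = dirac (a c) :> (set (T c) -> \bar R)) ->
  measurable_fun setT f -> measurable_fun setT g ->
  (forall x, 0 <= f x) -> (forall x, 0 <= g x) ->
  (forall x, (forall c, c \in A -> x c = a c) -> f x = g x) ->
  (forall c, c \in A -> c \notin s -> x c = a c) ->
  iints s f x = iints s g x.
Proof.
move=> mA mf mg f0 g0 fg; elim: s x => [x xA|c s IH x xA]; first by apply: fg => c /xA ->.
rewrite !iints_cons; have [cA|cA] := boolP (c \in A); last first.
  apply: eq_integral => t _; apply: IH => c' c'A c's.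
  have cc' : c != c' by apply: contraNneq cA => ->.
  by rewrite dfwithout// xA// in_cons negb_or eq_sym cc'.
rewrite mA// !integral_dirac//.
- congr (_ * _); apply: IH => c' c'A c's.
  have [->|cc'] := eqVneq c' c; first by rewrite dfwithin.
  by rewrite dfwithout 1?eq_sym// xA// in_cons negb_or cc'.
- by apply: (measurable_section (f := iints s g)); exact: measurable_iints.
- by apply: (measurable_section (f := iints s f)); exact: measurable_iints.
Qed.

End iterated_integral_theory.

(** Each coordinate of [s1] is moved past the whole of [s2] by [iints_fubini]. *)
Lemma iints_exchange {R : realType} {C1 C2 : finType}
    {d1 : C1 -> measure_display} {d2 : C2 -> measure_display}
    {T1 : forall c, measurableType (d1 c)} {T2 : forall c, measurableType (d2 c)}
    (m1 : forall c, {sigma_finite_measure set T1 c -> \bar R})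
    (m2 : forall c, {sigma_finite_measure set T2 c -> \bar R})
    (s1 : seq C1) (s2 : seq C2)
    (f : prodspace T1 -> prodspace T2 -> \bar R) x1 x2 :
  measurable_fun setT (fun z : prodspace T1 * prodspace T2 => f z.1 z.2) ->
  (forall y1 y2, 0 <= f y1 y2) ->
  iints m1 s1 (fun y1 => iints m2 s2 (f y1) x2) x1 =
  iints m2 s2 (fun y2 => iints m1 s1 (f ^~ y2) x1) x2.
Proof.
move=> mf f0; elim: s1 x1 => // c s1 IH x1; rewrite iints_cons.
under eq_integral do rewrite IH.
pose F (z : T1 c * prodspace T2) := iints m1 s1 (f ^~ z.2) (dfwith x1 c z.1).
have mF : measurable_fun setT F.
  have mf' : measurable_fun setT (fun z : prodspace T2 * prodspace T1 => f z.2 z.1).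
    apply: (measurableT_comp mf (g := fun z : prodspace T2 * prodspace T1 => (z.2, z.1))).
    by apply: measurable_fun_pair.
  apply: (measurableT_comp (measurable_iints_param m1 s1 mf' (fun=> f0 _ _))
    (g := fun z : T1 c * prodspace T2 => (z.2, dfwith x1 c z.1 : prodspace T1))).
  by apply: measurable_fun_pair => //; exact: measurable_dfwith.
by rewrite (@iints_fubini _ _ _ _ m2 _ _ (m1 c) s2 F)// => z; exact: iints_ge0.
Qed.

(** * Factorization of the ICM density and of its marginals *)

Section icm_factorization.
Context {R : realType} {d : nat} {e : rel 'I_d} {dT : 'I_d -> measure_display}.
Context {T : forall i, measurableType (dT i)}.
Variable mu : forall i, {sigma_finite_measure set T i -> \bar R}.
Context {dH : 'I_d -> measure_display} {Theta : forall i, measurableType (dH i)}.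
Variable nu : forall i, probability (Theta i) R.
Variable k : forall i, Theta i -> rowspace T (PA e i) -> T i -> R.
Variable N : nat.

Hypothesis acyc : acyclic e.
Hypothesis mk : forall i, measurable_fun setT
  (fun z : Theta i * rowspace T (PA e i) * T i => k z.1.1 z.1.2 z.2).
Hypothesis k0 : forall i th pa t, (0 <= k (i:=i) th pa t)%R.
Hypothesis k1 : forall i th pa, \int[mu i]_t (k (i:=i) th pa t)%:E = 1.

Let coord := ('I_d * 'I_N)%type.

(** Indexing the kernels by coordinates turns the double product over positions and variables into a
    single one. *)
Definition cdens (th : prodspace Theta) (c : coord) (x : array T N) : R :=
  k (th c.1) (pa (e:=e) (i:=c.1) x c.2) (x (c.1, c.2)).

(* The de Finetti mixture of the i-th mechanism over the positions in S. *)
Definition mech (i : 'I_d) (S : {set 'I_N}) (x : array T N) : \bar R :=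
  \int[nu i]_t (\prod_(n in S) k t (pa (e:=e) (i:=i) x n) (x (i, n)))%:E.

Lemma measurable_cdens {dY} {Y : measurableType dY} c
    (th : Y -> Theta c.1) (x : Y -> array T N) :
  measurable_fun setT th -> measurable_fun setT x ->
  measurable_fun setT (fun y => k (th y) (pa (e:=e) (i:=c.1) (x y) c.2) (x y (c.1, c.2))).
Proof.
move=> mth mx; apply: (measurableT_comp (mk (i:=c.1)) (g := fun y =>
  (th y, pa (e:=e) (i:=c.1) (x y) c.2 : rowspace T (PA e c.1), x y (c.1, c.2) : T c.1))).
apply: measurable_fun_pair.
  apply: measurable_fun_pair => //; apply: measurable_to_prodspace => j.
  exact: (@measurable_fun_coord _ _ (fun c : coord => T c.1) _ _ (val j, c.2) x).
exact: (@measurable_fun_coord _ _ (fun c : coord => T c.1) _ _ (c.1, c.2) x).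
Qed.

(** The kernel at [c] reads only [c] itself and the parents of [c.1] at the same position. *)
Lemma cdens_dfwith th (c c' : coord) x t :
  c != c' -> ~~ (e c'.1 c.1 && (c'.2 == c.2)) ->
  cdens th c (dfwith x c' t) = cdens th c x.
Proof.
case: c c' t => i n [i' n'] /= t cc' ne; rewrite /cdens /= dfwithout 1?eq_sym//.
congr (k _ _ _); apply/functional_extensionality_dep => j; rewrite /pa.
rewrite dfwithout//; apply: contra ne => /eqP[-> ->].
by have := valP j; rewrite inE => ->/=.
Qed.

Lemma acyclic_irrefl i : e i i = false.
Proof.
by apply/negP => eii; have := acyc eii; rewrite connect0.
Qed.

(** By acyclicity [i] is not its own parent, so updating coordinate [(i, n)] leaves the parent
    values fixed and the normalization of [k] applies. *)
Lemma int_cdens th (c : coord) x :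
  \int[mu c.1]_t (cdens th c (dfwith x c t))%:E = 1.
Proof.
case: c => i n; rewrite -[RHS](k1 (th i) (pa (e:=e) (i:=i) x n)).
apply: eq_integral => t _; rewrite /cdens /= dfwithin.
congr (k _ _ _)%:E; apply/functional_extensionality_dep => j; rewrite /pa.
rewrite dfwithout//; apply/eqP => -[ij].
have : sval j \in PA e i by exact: valP.
by rewrite inE -ij acyclic_irrefl.
Qed.

(** The number of ancestors of [i], itself included; it is the rank used in [iint_prod_kernel]. *)
Definition depth (i : 'I_d) : nat := #|[set j | connect e j i]%SET|.

(** Ancestors of [i] are ancestors of [j], and [j] is an additional one by acyclicity. *)
Lemma edge_depth i j : e i j -> (depth i < depth j)%N.
Proof.
move=> eij; apply: proper_card; apply/properP; split.
  apply/fintype.subsetP => l; rewrite !inE => li.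
  exact: connect_trans li (connect1 eij).
by exists j; rewrite inE ?connect0//; exact: acyc.
Qed.

Lemma measurable_prod_cdens (P : pred coord) : measurable_fun setT
  (fun z : prodspace Theta * array T N => (\prod_(c | P c) cdens z.1 c z.2)%:E).
Proof.
apply/measurable_EFinP; apply: measurable_prod_cond => c _.
apply: (measurable_cdens (th := fun z : prodspace Theta * array T N => z.1 c.1)) => //.
exact: (@measurable_fun_coord _ _ Theta _ _ c.1 fst measurable_fst).
Qed.

(** Grouped by variable, the product has one factor per [theta_i], and the mixing measure is the
    product of the [nu i]. *)
Lemma iintT_cdens (P : pred coord) x :
  iintT (fun i => nu i : set (Theta i) -> \bar R)
    (fun th => (\prod_(c | P c) cdens th c x)%:E) =
  \prod_i mech i [set n | P (i, n)] x.
Proof.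
pose G i (t : Theta i) : R := (\prod_(n in [set n | P (i, n)]%SET) k t (pa (e:=e) (i:=i) x n) (x (i, n)))%R.
rewrite -[RHS]/(\prod_i \int[nu i]_t (G i t)%:E).
rewrite -(@iintT_prod_coord _ _ _ _ nu)//; last 2 first.
- move=> i; apply: measurable_prod_cond => n _.
  exact: (measurable_cdens (c := (i, n)) (th := id) (x := fun=> x)).
- by move=> i t; apply: prodr_ge0 => n _; exact: k0.
congr iintT; apply/funext => th; congr EFin.
rewrite /G pair_big_dep/=; apply: eq_bigl => -[i n] /=.
by rewrite inE.
Qed.

Lemma icm_densityE x :
  icm_density nu k x = iintT (fun i => nu i : set (Theta i) -> \bar R)
    (fun th => (\prod_(c : coord) cdens th c x)%:E).
Proof.
congr iintT; apply/funext => th; congr EFin.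
by rewrite exchange_big/= pair_bigA.
Qed.

(** Tonelli brings the integral over [D] inside the mixture. For fixed parameters, closure under
    children lets [iint_prod_kernel] remove the kernels of [D]. *)
Lemma iint_icm_density (D : {set coord}) x :
  (forall i j n, (i, n) \in D -> e i j -> (j, n) \in D) ->
  iint (refm mu (N := N)) D (@icm_density _ _ _ _ _ _ _ nu k N) x =
  \prod_i mech i [set n | (i, n) \notin D] x.
Proof.
move=> Dch; rewrite (_ : icm_density nu k (N := N) = fun x =>
  iints nu (enum [set: 'I_d]%SET)
    (fun th => (\prod_(c : coord) cdens th c x)%:E) point); last first.
  by apply/funext => y; exact: icm_densityE.
rewrite -[LHS](@iints_exchange _ _ _ _ _ _ _ nu (fun c : coord => mu c.1) _ _
  (fun th y => (\prod_(c : coord) cdens th c y)%:E)); last 2 first.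
- exact: measurable_prod_cdens.
- by move=> th y; rewrite lee_fin prodr_ge0// => c _; exact: k0.
rewrite -(iintT_cdens (fun c => c \notin D)); congr (iints nu _ _ point); apply/funext => th.
apply: (@iint_prod_kernel _ _ _ _ (fun c : coord => mu c.1)
  (fun c c' : coord => e c.1 c'.1 && (c.2 == c'.2)) (fun c => depth c.1)).
- move=> c; apply: (measurable_cdens (th := fun=> th c.1)) => //.
- by move=> c y; exact: k0.
- by move=> c c' y t; exact: cdens_dfwith.
- exact: int_cdens.
- by move=> c c' /andP[/edge_depth].
- by move=> [i n] [j n'] /= inD /andP[eij /eqP <-]; exact: Dch inD eij.
Qed.

(** * Conditional densities of a variable given its parents *)

Lemma mech_ge0 i S x : 0 <= mech i S x.
Proof.
by apply: integral_ge0 => t _; rewrite lee_fin prodr_ge0// => n _; exact: k0.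
Qed.

Lemma mech0 i x : mech i finset.set0 x = 1.
Proof.
rewrite /mech; under eq_integral do rewrite big_set0.
by rewrite integral_cst// mul1e; exact: probability_setT.
Qed.

Lemma mech_dfwith i S x (c : coord) t :
  c \notin var_coords i S :|: pa_coords e i S ->
  mech i S (dfwith x c t) = mech i S x.
Proof.
move=> cS; apply: eq_integral => th _; congr EFin; apply: eq_bigr => n nS.
have out (j : 'I_d) : j \in i |: PA e i -> c != (j, n).
  by apply: contraTneq => cE; move: cS; rewrite cE !inE nS !andbT.
rewrite dfwithout ?out ?setU11//.
congr (k _ _ _); apply/functional_extensionality_dep => j; rewrite /pa.
by rewrite dfwithout// out// setU1r//; exact: valP.
Qed.

Lemma iint_setU (S1 S2 : {set coord}) f x :
  measurable_fun setT f -> (forall x, 0 <= f x) -> S1 :&: S2 = finset.set0 ->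
  iint (refm mu (N := N)) (S1 :|: S2) f x =
  iint (refm mu (N := N)) S1 (iint (refm mu (N := N)) S2 f) x.
Proof.
move=> mf f0 S12.
rewrite -[RHS](congr1 (fun g => g x) (iints_cat (fun c : coord => mu c.1) _ _ _)).
apply: iints_perm => //; apply: uniq_perm; rewrite ?enum_uniq//.
  rewrite cat_uniq !enum_uniq/= andbT; apply/hasPn => c; rewrite !mem_enum.
  by move=> cS2; apply/negP => cS1; have := finset.in_set0 c;
    rewrite -S12 inE cS1 cS2.
by move=> c; rewrite mem_cat !mem_enum inE.
Qed.

(** The numerator is the integral over [E] of [mech i S * M], the denominator that of [M]. As
    [mech i S] is constant along [E], it comes out, and the rest cancels because the denominator is
    positive and finite. *)
Lemma mech_densityE (i : 'I_d) (S : {set 'I_N}) x :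
  measurable_fun setT (@icm_density _ _ _ _ _ _ _ nu k N) ->
  mech_density_defined e mu (@icm_density _ _ _ _ _ _ _ nu k N) i S x ->
  mech_density e mu (@icm_density _ _ _ _ _ _ _ nu k N) i S x = mech i S x.
Proof.
set p := icm_density _ _ (N := N) => mp.
have p0 y : 0 <= p y.
  by rewrite /p icm_densityE; apply: (@iints_ge0 _ _ _ _ nu) => th;
    rewrite lee_fin prodr_ge0// => c _; exact: k0.
(* D b holds the coordinates of i and its descendants, except the (i, n) with
   n in S when b holds: it is closed under children. E completes D true, resp.
   D false, to the set of coordinates integrated out in the numerator, resp. the
   denominator, of the conditional density. *)
pose E : {set coord} :=
  [set c | (c.1 \in ND e i) && ~~ ((c.1 \in PA e i) && (c.2 \in S))]%SET.
pose D (b : bool) : {set coord} :=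
  [set c | connect e i c.1 && ~~ [&& c.1 == i, c.2 \in S & b]]%SET.
have PAND j : j \in PA e i -> ~~ connect e i j by rewrite inE; exact: acyc.
have ED b : E :&: D b = finset.set0.
  apply/setP => c; rewrite !inE.
  by case: (connect e i c.1); rewrite ?andbF.
have Dch b j l n : (j, n) \in D b -> e j l -> (l, n) \in D b.
  rewrite !inE /= => /andP[ij _] ejl.
  rewrite (connect_trans ij (connect1 ejl))/=.
  (* The coordinates excluded from [D] belong to [i], which cannot be a child of its own descendant
     [j]. *)
  by apply: contraTN (acyc ejl) => /and3P[/eqP -> _ _]; rewrite negbK.
have EE j n : ((j, n) \in E) = ~~ connect e i j && ~~ ((j \in PA e i) && (n \in S)).
  by rewrite /E finset.in_set /= [_ \in ND e i]finset.in_set.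
have DE b j n : ((j, n) \in D b) = connect e i j && ~~ [&& j == i, n \in S & b].
  by rewrite /D finset.in_set.
have iPA : i \notin PA e i by rewrite inE acyclic_irrefl.
have UE : ~: (var_coords i S :|: pa_coords e i S) = E :|: D true.
  apply/setP => -[j n]; rewrite finset.in_setC !finset.in_setU EE DE andbT.
  rewrite !finset.in_setX /= finset.in_set1.
  have [->|ji] := eqVneq j i; first by rewrite (negbTE iPA) connect0/= orbF.
  have [/PAND/negbTE ->|_] := boolP (j \in PA e i); first by rewrite /= orbF.
  by rewrite /= !andbT orNb.
have PE : ~: pa_coords e i S = E :|: D false.
  apply/setP => -[j n]; rewrite finset.in_setC !finset.in_setU EE DE !andbF andbT.
  rewrite !finset.in_setX /=.
  have [/PAND/negbTE ->|_] := boolP (j \in PA e i); first by rewrite /= orbF.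
  by rewrite /= !andbT orNb.
(* For [j != i], [D true] and [D false] contain the same coordinates of [j], so one [M] serves
   both. *)
pose M y := \prod_(j | j != i) mech j [set n | (j, n) \notin D false] y.
have intD b y : iint (refm mu (N := N)) (D b) p y =
    mech i (if b then S else finset.set0) y * M y.
  rewrite iint_icm_density//; last exact: Dch.
  rewrite (bigD1 i isT)/=; apply: congr2.
    congr (mech i _ y); by apply/setP => n; case: b; rewrite !inE connect0 eqxx/= ?andbT ?andbF ?negbK.
  apply: eq_bigr => j ji; congr (mech j _ y); apply/setP => n.
  by rewrite !inE (negbTE ji).
have mM : measurable_fun setT M.
  rewrite (_ : M = iint (refm mu (N := N)) (D false) p).
    by apply: (@measurable_iints _ _ _ _ (fun c : coord => mu c.1)).
  by apply/funext => y; rewrite intD mech0 mul1e.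
have M0 y : 0 <= M y by apply: prode_ge0 => j _; exact: mech_ge0.
rewrite /mech_density /mech_density_defined /cond_density /cond_density_defined.
rewrite /marginal UE PE !iint_setU//.
rewrite (_ : iint _ (D true) p = fun y => mech i S y * M y); last first.
  by apply/funext => y; exact: intD.
rewrite (_ : iint _ (D false) p = M); last first.
  by apply/funext => y; rewrite intD mech0 mul1e.
have -> : iint (refm mu (N := N)) E (fun y => mech i S y * M y) x =
    mech i S x * iint (refm mu (N := N)) E M x.
  apply: (@iints_mull _ _ _ _ (fun c : coord => mu c.1) (enum E) M (mech i S)) => //.
    by move=> y; exact: mech_ge0.
  move=> y c t; rewrite mem_enum => cE; apply: mech_dfwith.
  by rewrite -finset.in_setC UE inE cE.
move=> /andP[I0 Ioo]; rewrite -muleA divee ?mule1//; last by rewrite gt_eqF.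
by rewrite ge0_fin_numE// ltW.
Qed.

(** * The interventional law and its density *)

Variables (Xs : {set coord}) (xhat : array T N).
Hypothesis mXs : forall c, c \in Xs -> measurable [set xhat c].

Definition do_cdens (th : prodspace Theta) (c : coord) (x : array T N) : R :=
  if c \in Xs then (x c == xhat c)%:R else cdens th c (subst Xs xhat x).

(** [do_refm] with its values packaged as sigma-finite measures, as Tonelli requires. *)
Definition do_measure (c : coord) : {sigma_finite_measure set T c.1 -> \bar R} :=
  if c \in Xs then (\d_(xhat c) : {sigma_finite_measure set T c.1 -> \bar R}) else mu c.1.

Lemma do_refmE : @do_refm _ _ _ _ mu _ Xs xhat = do_measure.
Proof.
apply/functional_extensionality_dep => c.
by rewrite /do_refm /do_measure; case: ifP.
Qed.

Lemma do_cdens_ge0 th c x : (0 <= do_cdens th c x)%R.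
Proof. by rewrite /do_cdens; case: ifP => // _; exact: k0. Qed.

Lemma measurable_subst : measurable_fun setT (subst Xs xhat : array T N -> array T N).
Proof.
apply: measurable_to_prodspace => c; rewrite /subst; case: (c \in Xs).
  exact: measurable_cst.
exact: measurable_coord.
Qed.

Lemma measurable_do_cdens c : measurable_fun setT
  (fun z : prodspace Theta * array T N => do_cdens z.1 c z.2).
Proof.
rewrite /do_cdens; case: (boolP (c \in Xs)) => cXs; last first.
  apply: (measurable_cdens (th := fun z : prodspace Theta * array T N => z.1 c.1)
    (x := fun z => subst Xs xhat z.2)).
    exact: (@measurable_fun_coord _ _ Theta _ _ c.1 fst measurable_fst).
  exact: (measurableT_comp measurable_subst measurable_snd).
(* The delta factor is the indicator of a singleton, measurable by [mXs]. *)
rewrite (_ : (fun _ => _) = \1_[set xhat c] \o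
    (fun z : prodspace Theta * array T N => z.2 c)); last first.
  apply/funext => z /=; rewrite indicE; congr ((nat_of_bool _)%:R).
  by apply/eqP/idP => [->|]; rewrite inE.
apply: measurableT_comp; first exact/measurable_indic/mXs.
exact: (@measurable_fun_coord _ _ (fun c : coord => T c.1) _ _ c snd measurable_snd).
Qed.

Lemma measurable_prod_do_cdens : measurable_fun setT
  (fun z : prodspace Theta * array T N => (\prod_c do_cdens z.1 c z.2)%:E).
Proof.
apply/measurable_EFinP.
by apply: measurable_prod_cond => c _; exact: measurable_do_cdens.
Qed.

Lemma do_densityE x : do_density nu k Xs xhat x =
  iintT (fun i => nu i : set (Theta i) -> \bar R)
    (fun th => (\prod_(c : coord) do_cdens th c x)%:E).
Proof.
congr iintT; apply/funext => th; congr EFin.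
rewrite exchange_big/= pair_bigA; apply: eq_bigr => -[i n] _.
by rewrite /do_cdens /cdens /subst /=; case: ifPn => //= /negbTE ->.
Qed.

Lemma subst_id x : (forall c, c \in Xs -> x c = xhat c) -> subst Xs xhat x = x.
Proof.
move=> xE; apply/functional_extensionality_dep => c; rewrite /subst.
by case: ifP => // /xE.
Qed.

Lemma prod_do_cdens th x : (forall c, c \in Xs -> x c = xhat c) ->
  (\prod_c do_cdens th c x = \prod_(c | c \notin Xs) cdens th c x)%R.
Proof.
move=> xE; rewrite (bigID (mem Xs))/= big1 ?mul1r => [|c cXs].
  by apply: eq_bigr => c /negbTE cXs; rewrite /do_cdens cXs subst_id.
by rewrite /do_cdens cXs xE// eqxx.
Qed.

(** After Tonelli both sides mix over the parameters an integral against [do_refm]. The integrands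
    differ only by the delta factors, which equal 1 wherever the Dirac measures put mass. *)
Lemma has_density_do :
  has_density (@do_refm _ _ _ _ mu _ Xs xhat) (do_law mu nu k Xs xhat)
    (do_density nu k Xs xhat).
Proof.
have mprod : measurable_fun setT
    (fun z : array T N * prodspace Theta => (\prod_c do_cdens z.2 c z.1)%:E).
  apply: (measurableT_comp measurable_prod_do_cdens
    (g := fun z : array T N * prodspace Theta => (z.2, z.1))).
  exact: measurable_fun_pair.
have prod0 z : 0 <= (\prod_(c : coord) do_cdens z.1 c z.2)%:E.
  by rewrite lee_fin prodr_ge0// => c _; exact: do_cdens_ge0.
split.
- rewrite (_ : do_density _ _ _ _ = fun x =>
      iints nu (enum [set: 'I_d]%SET)
        (fun th => (\prod_c do_cdens th c x)%:E) point); last first.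
    by apply/funext => x; exact: do_densityE.
  apply: (measurableT_comp (measurable_iints_param nu (enum [set: 'I_d]%SET) mprod
    (fun z => prod0 (z.2, z.1))) (g := fun x : array T N => (x, point))).
  exact: measurable_fun_pair.
- move=> x; rewrite do_densityE; apply: (@iints_ge0 _ _ _ _ nu) => th.
  exact: prod0 (th, x).
move=> A mA; rewrite do_refmE /do_law.
have mind : measurable_fun setT (fun x : array T N => (\1_A x)%:E : \bar R).
  by apply/measurable_EFinP; exact: measurable_indic.
have ind0 x : 0 <= (\1_A x)%:E :> \bar R by rewrite lee_fin.
rewrite [RHS](_ : _ = iints do_measure (enum [set: coord]%SET) (fun x =>
  iints nu (enum [set: 'I_d]%SET)
    (fun th => (\1_A x)%:E * (\prod_c do_cdens th c x)%:E) point) point); last first.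
  apply: (congr1 (fun f => iints do_measure _ f point)); apply/funext => x.
  rewrite (@iints_mull _ _ _ _ nu _ (fun th => (\prod_c do_cdens th c x)%:E)
    (fun=> (\1_A x)%:E))//.
  - by rewrite muleC do_densityE.
  - apply: (measurableT_comp mprod (g := fun th : prodspace Theta => (x, th))).
    exact: measurable_fun_pair.
  - by move=> th; exact: prod0 (th, x).
rewrite -(@iints_exchange _ _ _ _ _ _ _ nu do_measure _ _
  (fun th x => (\1_A x)%:E * (\prod_c do_cdens th c x)%:E)); last 2 first.
- apply: emeasurable_funM; last exact: measurable_prod_do_cdens.
  exact: (measurableT_comp mind measurable_snd).
- by move=> th x; apply: mule_ge0 => //; exact: prod0 (th, x).
congr iintT; apply/funext => th; rewrite do_refmE.
apply: (@eq_iints_dirac _ _ _ _ do_measure xhat Xs).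
- by move=> c cXs; rewrite /do_measure cXs.
- apply: emeasurable_funM => //; apply/measurable_EFinP.
  apply: measurable_prod_cond => n _; apply: measurable_prod_cond => i iXs.
  rewrite (_ : (fun _ => _) = fun x => cdens th (i, n) (subst Xs xhat x)).
    by apply: (measurable_cdens (c := (i, n)) (th := fun=> th i));
      [exact: measurable_cst | exact: measurable_subst].
  by apply/funext => x; rewrite /cdens /subst /= (negbTE iXs).
- apply: emeasurable_funM => //.
  apply: (measurableT_comp mprod (g := fun x : array T N => (x, th))).
  exact: measurable_fun_pair.
- move=> x; rewrite mule_ge0// lee_fin; apply: prodr_ge0 => n _.
  by apply: prodr_ge0 => i _; exact: k0.
- by move=> x; apply: mule_ge0 => //; exact: prod0 (th, x).
- move=> x xE; rewrite muleC prod_do_cdens// subst_id//; congr (_ * _%:E).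
  rewrite (exchange_big_dep predT)//= pair_big_dep/=.
  by apply: eq_big => [[i n]|[i n] _].
- by move=> c _; rewrite mem_enum inE.
Qed.

Lemma do_density_consistent x : consistent Xs xhat x ->
  do_density nu k Xs xhat x = \prod_i mech i (free_pos Xs i) x.
Proof.
move=> /forallP xE; have {}xE c : c \in Xs -> x c = xhat c.
  by move=> cXs; apply/eqP; have := xE c; rewrite cXs.
rewrite do_densityE -(iintT_cdens (fun c => c \notin Xs)).
congr iintT; apply/funext => th; congr EFin.
exact: prod_do_cdens.
Qed.

Lemma do_density_inconsistent x : ~~ consistent Xs xhat x ->
  do_density nu k Xs xhat x = 0.
Proof.
rewrite negb_forall => /existsP[c]; rewrite negb_imply => /andP[cXs xc].
(* The factor at the violated coordinate [c] vanishes. Writing the integrand as [0 * 0] lets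
   [iints_mull] extract a zero. *)
rewrite do_densityE (_ : (fun _ => _) = fun=> 0 * 0); last first.
  apply/funext => th; rewrite (bigD1 c)//= /do_cdens cXs (negbTE xc).
  by rewrite mul0r mul0e.
by rewrite [LHS](@iints_mull _ _ _ _ nu _ (fun=> 0) (fun=> 0))// mul0e.
Qed.

End icm_factorization.

(** * The truncated factorization *)

Theorem theorem1 (R : realType) (d : nat) (e : rel 'I_d)
  (dT : 'I_d -> measure_display) (T : forall i, measurableType (dT i))
  (mu : forall i, {sigma_finite_measure set T i -> \bar R})
  (dO : measure_display) (Omega : measurableType dO)
  (P : probability Omega R) (X : forall i, nat -> {RV P >-> T i})
  (dH : 'I_d -> measure_display) (Theta : forall i, measurableType (dH i))
  (nu : forall i, probability (Theta i) R)
  (k : forall i, Theta i -> rowspace T (PA e i) -> T i -> R)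
  (p : forall n, array T n -> \bar R)
  (N : nat) (Xs : {set 'I_d * 'I_N}) (xhat : array T N) :
  acyclic e ->
  (forall c, c \in Xs -> measurable [set xhat c]) ->
  icm_process X e ->
  (forall n, has_density (refm mu (N := n)) (data_law X (N := n)) (p n)) ->
  is_cond_density_family mu k ->
  (forall n x, p n x = icm_density nu k x) ->
  has_density (do_refm mu Xs xhat) (do_law mu nu k Xs xhat)
    (do_density nu k Xs xhat) /\
  forall x : array T N,
    (consistent Xs xhat x ->
     forall i, mech_density_defined e mu (p N) i (free_pos Xs i) x) ->
    do_density nu k Xs xhat x = truncated_factorization e mu Xs xhat (p N) x.
Proof.
move=> acyc mXs _ pdens kfam pE.
have mk i := let: And3 mk _ _ := kfam i in mk.
have k0 i := let: And3 _ k0 _ := kfam i in k0.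
have k1 i := let: And3 _ _ k1 := kfam i in k1.
have pNE : p N = @icm_density _ _ _ _ _ _ _ nu k N by apply/funext => x; exact: pE.
have [mp _ _] := pdens N; rewrite pNE in mp.
split=> [|x]; first exact: has_density_do.
rewrite pNE /truncated_factorization.
case: ifPn => xE; last by move=> _; exact: do_density_inconsistent.
move=> /(_ isT) pdef.
rewrite do_density_consistent// (bigID (mem (int_vars Xs)))/=; congr (_ * _).
  by apply: eq_bigr => i _; rewrite mech_densityE.
apply: eq_bigr => i iXs.
(* A variable outside [int_vars] has no intervened position, so all its positions are free. *)
have <- : free_pos Xs i = [set: 'I_N]%SET.
  apply/setP => n; rewrite !inE; apply: contra iXs => inX.
  by apply/imsetP; exists (i, n).
by rewrite mech_densityE.
Qed.
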